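(* Let $\beta\ge(1+\sqrt5)/2$ be an Yrrap number, and let $\cdots u_{-1}u_0u_1\cdots$ be the two-sided infinite word over $A_\beta$ with $u_0=0$ such that $\psi_\beta^{2n}(\widehat 0)$ is a prefix of $u_1u_2\cdots$ and $\psi_\beta^{2n+1}(\widehat 0)$ is a suffix of $\cdots u_{-2}u_{-1}$ for all $n\ge0$. For $k\in\mathbb{Z}$ set $z_k=\sum_{j=1}^k\lambda(J_{u_{2j-1}})$ if $k\ge0$ and $z_k=-\sum_{j=1}^{|k|}\lambda(J_{u_{-2j+1}})$ if $k\le0$. Then \[ \mathbb{Z}_{-\beta}=\{z_k: k\in\mathbb{Z},\ u_{2k}=0\}. \]
   Context: For $\beta>1$, $T_{-\beta}:I_\beta\to I_\beta$, $I_\beta=\big[\tfrac{-\beta}{\beta+1},\tfrac{1}{\beta+1}\big)$, $T_{-\beta}(x)=-\beta x-\big\lfloor \tfrac{\beta}{\beta+1}-\beta x\big\rfloor$, and $\mathbb{Z}_{-\beta}=\bigcup_{n\ge0}(-\beta)^nT_{-\beta}^{-n}(0)$. Let $V_\beta=\{T_{-\beta}^n(\tfrac{-\beta}{\beta+1}):n\ge0\}$; $\beta$ is Yrrap if $V_\beta$ is finite. Let $V'_\beta=V_\beta\cup\{0\}$, and for $x\in V'_\beta$ let $r_x=\min\{y\in V'_\beta\cup\{\tfrac1{\beta+1}\}:y>x\}$, $\widehat x=\tfrac{x+r_x}{2}$, $J_x=\{x\}$, $J_{\widehat x}=(x,r_x)$. The alphabet is $A_\beta=V'_\beta\cup\{\widehat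 x:x\in V'_\beta\}$, $\lambda$ is Lebesgue measure (so $\lambda(J_x)=0$, $\lambda(J_{\widehat x})=r_x-x$). For $x\in V'_\beta$ write $(x,r_x)\cap T_{-\beta}^{-1}(V'_\beta)=\{y_1<\cdots<y_m\}$, $y_0=x$, $y_{m+1}=r_x$, and $x_i=\lim_{y\to y_{i+1}^-}T_{-\beta}(y)\in V'_\beta$. The anti-morphism $\psi_\beta:A_\beta^*\to A_\beta^*$ (i.e. $\psi_\beta(uv)=\psi_\beta(v)\psi_\beta(u)$) is defined by $\psi_\beta(x)=T_{-\beta}(x)$ and $\psi_\beta(\widehat x)=\widehat{x_m}\,T_{-\beta}(y_m)\cdots\widehat{x_1}\,T_{-\beta}(y_1)\,\widehat{x_0}$ for $x\in V'_\beta$. (The two-sided word described in the claim exists and is unique.) *)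

(* Defs.v *)
From HB Require Import structures.
From mathcomp Require Import all_boot all_order all_algebra.
From mathcomp Require Import finmap.
From mathcomp Require Import all_classical all_reals all_analysis.

Set Implicit Arguments.
Unset Strict Implicit.
Unset Printing Implicit Defensive.

Import Order.TTheory GRing.Theory Num.Theory.
Import numFieldNormedType.Exports.

Local Open Scope classical_set_scope.
Local Open Scope ring_scope.

Section NegativeBeta.
Context {R : realType}.
Implicit Types (beta x a : R) (w : seq R) (u : int -> R).

Definition Ileft beta : R := - beta / (beta + 1).
Definition Iright beta : R := (beta + 1)^-1.

Definition Ibeta beta : set R := `[Ileft beta, Iright beta[.

(* The formula is used on all of R; only its values on [Ibeta beta], which it
   maps to itself, are relevant. *)
Definition Tneg beta x : R :=
  - beta * x - (Num.floor (beta / (beta + 1) - beta * x))%:~R.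

Definition neg_beta_integers beta : set R :=
  \bigcup_n [set (- beta) ^+ n * x |
             x in Ibeta beta `&` [set x | iter n (Tneg beta) x = 0]].

Definition Vset beta : set R := range (fun n => iter n (Tneg beta) (Ileft beta)).

Definition yrrap beta : Prop := finite_set (Vset beta).

Definition V'set beta : set R := Vset beta `|` [set 0].

(* Minimum of a set of reals (default value 0 if it is not attained). *)
Definition set_min (S : set R) : R := xget 0 (S `&` lbound S).

Definition rnext beta x : R :=
  set_min [set y | (V'set beta `|` [set Iright beta]) y /\ x < y].

Definition hat beta x : R := (x + rnext beta x) / 2.

Definition alphabet beta : set R := V'set beta `|` hat beta @` V'set beta.

(* For a letter [a] outside [V'set beta], the [x] such that [a = hat beta x]. *)
Definition unhat beta a : R := xget 0 [set x | V'set beta x /\ hat beta x = a].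

Definition Jset beta a : set R :=
  if a \in V'set beta then [set a]
  else `]unhat beta a, rnext beta (unhat beta a)[%classic.

Definition J_length beta a : R := fine (lebesgue_measure (Jset beta a)).

(* The increasing sequence y_1 < ... < y_m; [fset_set] is the empty fset
   on infinite sets. *)
Definition cuts beta x : seq R :=
  sort <=%R (fset_set (`]x, rnext beta x[ `&`
    (Ibeta beta `&` Tneg beta @^-1` V'set beta))).

(* y_0 = x, y_1, ..., y_m, y_(m+1) = r_x *)
Definition cut beta x (i : nat) : R :=
  nth 0 (x :: rcons (cuts beta x) (rnext beta x)) i.

Definition cut_lim beta x (i : nat) : R :=
  lim (Tneg beta y @[y --> (cut beta x i.+1)^'-]).

(* hat x_m, T y_m, ..., hat x_1, T y_1, hat x_0 *)
Definition psi_hat beta x : seq R :=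
  rev (hat beta (cut_lim beta x 0) ::
       flatten [seq [:: Tneg beta (cut beta x i); hat beta (cut_lim beta x i)]
               | i <- iota 1 (size (cuts beta x))]).

Definition psi_letter beta a : seq R :=
  if a \in V'set beta then [:: Tneg beta a] else psi_hat beta (unhat beta a).

Definition psi beta w : seq R := flatten (rev (map (psi_letter beta) w)).

Definition prefix_right w u : Prop :=
  w = mkseq (fun i => u (i%:Z + 1)) (size w).

Definition suffix_left w u : Prop :=
  w = mkseq (fun i => u (i%:Z - (size w)%:Z)) (size w).

Definition psi_biinfinite_word beta u : Prop :=
  [/\ forall k, alphabet beta (u k),
      u 0 = 0,
      forall n, prefix_right (iter n.*2 (psi beta) [:: hat beta 0]) u
    & forall n, suffix_left (iter n.*2.+1 (psi beta) [:: hat beta 0]) u].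

Definition zpoint beta u (k : int) : R :=
  if 0 <= k
  then \sum_(1 <= j < `|k|%N.+1) J_length beta (u (2 * j%:Z - 1))
  else - \sum_(1 <= j < `|k|%N.+1) J_length beta (u (- (2 * j%:Z) + 1)).

End NegativeBeta.

(* Main.v *)
Require Import Defs.
From HB Require Import structures.
From mathcomp Require Import all_boot all_order all_algebra.
From mathcomp Require Import finmap lra ring zify.
From mathcomp Require Import all_classical all_reals all_analysis.

Set Implicit Arguments.
Unset Strict Implicit.
Unset Printing Implicit Defensive.

Import Order.TTheory GRing.Theory Num.Theory.
Import numFieldNormedType.Exports.

Local Open Scope classical_set_scope.
Local Open Scope ring_scope.

(* Scale the n-th iterate: F_n(z) = T^n(z / (-beta)^n) has slope 1 wherever it is
   continuous, because (-beta)^n is the slope of T^n. It cuts the interval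
   between 0 and (-beta)^n r_0 at the points where it takes values in V', and
   translates each open piece onto a gap (x, r_x) of V'. Since T maps every
   branch inside a gap onto a gap, passing from F_n to F_(n+1) dilates the
   picture by -beta and applies psi to the word of labels (the reversal of
   orientation makes psi an anti-morphism). Hence psi^n(hat 0) lists the labels
   of F_n, its odd letters measure the lengths of the pieces, and u_2k = 0 means
   F_n(z_k) = 0 for every n of the right parity that is large enough. Conversely
   a point of (-beta)^n T^-n(0) is a zero of F_m for all large m, as
   T(x / -beta) = x in the interior of the interval. *)

Section TnegTiling.
Context {R : realType} (beta : R).
Context (beta_gt1 : 1 < beta) (fin : yrrap beta).

Let beta_gt0 : 0 < beta. Proof. exact: lt_trans beta_gt1. Qed.

Let beta_neq0 : beta != 0. Proof. by rewrite gt_eqF. Qed.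

Let betaD1_neq0 : beta + 1 != 0. Proof. by rewrite gt_eqF ?addr_gt0. Qed.

Local Notation T := (Tneg beta).
Local Notation V' := (V'set beta).
Local Notation next := (rnext beta).
Local Notation L := (Ileft beta).
Local Notation r := (Iright beta).

(** * The map [T] and the argument of its floor *)

Definition Tneg_arg (x : R) : R := beta / (beta + 1) - beta * x.
Local Notation g := Tneg_arg.

Lemma IleftE : L = r - 1.
Proof. by rewrite /Ileft /Iright; field. Qed.

Lemma Iright_gt0 : 0 < r.
Proof. by rewrite invr_gt0 addr_gt0. Qed.

Lemma Iright_lt1 : r < 1.
Proof. by rewrite invf_lt1 ?addr_gt0// ltrDr. Qed.

Lemma beta_Iright : beta * r = 1 - r.
Proof. by rewrite /Iright; field. Qed.

Lemma Tneg_argE x : g x = 1 - r - beta * x.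
Proof. by rewrite /g -beta_Iright. Qed.

(** [T] is the fractional part of [g] shifted to start at [L], so it can jump only where the
    decreasing function [g] takes an integer value. *)
Lemma TnegE x : T x = g x + L - (Num.floor (g x))%:~R.
Proof. by rewrite IleftE Tneg_argE /Tneg -/(g x) Tneg_argE; ring. Qed.

Lemma Tneg_range x : L <= T x < r.
Proof.
rewrite TnegE; have := floor_itv (g x); rewrite intrD IleftE.
set f := _%:~R => /andP[H1 H2]; lra.
Qed.

Lemma Tneg_eq x (n : int) : n%:~R <= g x < n%:~R + 1 -> T x = g x + L - n%:~R.
Proof. by move=> H; rewrite TnegE (@floor_def _ _ n)// intrD. Qed.

Lemma Tneg_arg_int x (n : int) : g x = n%:~R -> T x = L.
Proof. by move=> gx; rewrite (@Tneg_eq x n) gx; lra. Qed.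

Lemma Tneg_divN x : L <= x < r -> T (x / - beta) = x.
Proof.
rewrite IleftE => /andP[H1 H2].
have gE : g (x / - beta) = x - L by rewrite IleftE Tneg_argE; field.
by rewrite (@Tneg_eq _ 0) gE IleftE; lra.
Qed.

Lemma Tneg0 : T 0 = 0.
Proof.
rewrite -{2}(@Tneg_divN 0) ?mul0r// IleftE.
by have := Iright_gt0; have := Iright_lt1; lra.
Qed.

(** The excluded endpoint [r] can be the right end of a gap; evaluating [T] there gives a value in
    [V'], so that this gap needs no separate treatment. *)
Lemma Tneg_Iright : T r = L.
Proof. by apply: (@Tneg_arg_int _ 0); rewrite Tneg_argE beta_Iright subrr. Qed.

(** * The finite set [V'], its gaps and their labels *)

Lemma V'_range x : V' x -> L <= x < r.
Proof.
have := Iright_gt0; have := Iright_lt1 => r1 r0.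
case=> [[[|n] _ <-]|->] /=; [|by rewrite Tneg_range|]; rewrite IleftE; lra.
Qed.

Lemma V'_Ileft : V' L. Proof. by left; exists 0. Qed.

Lemma V'_0 : V' 0. Proof. by right. Qed.

Lemma V'_Tneg x : V' x -> V' (T x).
Proof.
by case=> [[n _ <-]|->]; [left; exists n.+1 | rewrite Tneg0; right].
Qed.

Lemma V'_finite : finite_set V'.
Proof. by rewrite finite_setU. Qed.

Lemma finite_set_minP (S : set R) : finite_set S -> S !=set0 ->
  S (set_min S) /\ lbound S (set_min S).
Proof.
move=> /finite_seqP[s ->] [x /= xs]; apply: (@xgetPex _ 0 ([set` s] `&` _)).
elim: s x xs => // y [|z s] IH x _.
  by exists y; split=> [|t] /=; rewrite inE // => /eqP->.
have [m [ms mP]] := IH z (mem_head _ _).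
have [ym|my] := leP y m; [exists y|exists m]; split=> [|t] /=.
- by rewrite inE eqxx.
- by rewrite inE => /predU1P[->//|/mP]; exact: le_trans.
- by rewrite inE; apply/orP; right.
- by rewrite inE => /predU1P[->|/mP//]; exact: ltW.
Qed.

Lemma rnextP x : V' x ->
  [/\ V' (next x) \/ next x = r, x < next x
    & forall y, V' y \/ y = r -> x < y -> next x <= y].
Proof.
move=> Vx; set S := [set y | (V' `|` [set r]) y /\ x < y].
have finS : finite_set S.
  have : finite_set (V' `|` [set r]) by rewrite finite_setU; split=> //; exact: V'_finite.
  by apply: sub_finite_set => y [].
have [|[V1 V2] lb] := finite_set_minP finS.
  by exists r; split; [right|case/andP: (V'_range Vx)].
by split=> // y Vy xy; apply: lb; split.
Qed.

Lemma rnext_eq x y : V' x -> V' y \/ y = r -> x < y ->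
  (forall z, V' z -> x < z -> y <= z) -> next x = y.
Proof.
move=> Vx Vy xy min_y; have [Vn xn min_n] := rnextP Vx.
apply/le_anti; rewrite min_n//=; case: Vn => [/min_y->//|->].
by case: Vy => [/V'_range/andP[_ /ltW]|->].
Qed.

Lemma rnext_le x : V' x -> next x <= r.
Proof. by move=> Vx; have [_ _] := rnextP Vx; apply; [right|case/andP: (V'_range Vx)]. Qed.

Lemma rnext_gap x y : V' x -> x < y < next x -> ~ V' y.
Proof.
move=> Vx /andP[xy yn] Vy; have [_ _ min] := rnextP Vx.
by have := min y (or_introl Vy) xy; rewrite leNgt yn.
Qed.

Lemma rnext_sub_le1 x : V' x -> next x - x <= 1.
Proof.
by move=> Vx; have := rnext_le Vx; have /andP[+ _] := V'_range Vx; rewrite IleftE; lra.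
Qed.

Lemma V'_hatN x : V' x -> ~ V' (hat beta x).
Proof. by move=> Vx; apply: (rnext_gap Vx); have [_ + _] := rnextP Vx; rewrite /hat; lra. Qed.

Lemma hat_inj : {in V' &, injective (hat beta)}.
Proof.
move=> x y; rewrite !inE.
wlog xy : x y / x < y.
  move=> H Vx Vy e; have [xy|yx|//] := ltgtP x y; first exact: H.
  by apply/esym/H.
move=> Vx Vy; have [_ _ /(_ y (or_introl Vy) xy)] := rnextP Vx.
by have [_ + _] := rnextP Vy; rewrite /hat; lra.
Qed.

Lemma unhatK x : V' x -> unhat beta (hat beta x) = x.
Proof.
move=> Vx; apply: xget_unique => // y [Vy]; apply: hat_inj; exact/mem_set.
Qed.

Lemma J_length_hat x : V' x -> J_length beta (hat beta x) = next x - x.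
Proof.
move=> Vx; rewrite /J_length /Jset memNset; last exact: V'_hatN.
have [_ xn _] := rnextP Vx.
by rewrite unhatK// lebesgue_measure_itv/= lte_fin xn -EFinB.
Qed.

(** * Left limits of [T], and its branches inside a gap *)

(** As y increases to x, [g y] decreases to [g x], and the floor is right-continuous. Hence each
    [cut_lim] is just the value of [T] at the next cut. *)
Lemma Tneg_cvg_left x : T y @[y --> x^'-] --> T x.
Proof.
have /andP[fl fu] := floor_itv (g x).
have gap : 0 < (Num.floor (g x) + 1)%:~R - g x by rewrite subr_gt0.
have affine : \forall y \near x^'-, T x + beta * (x - y) = T y.
  near=> y.
  have yx : y < x by near: y; exact: nbhs_left_lt.
  (* This distance keeps [g y] below the integer following [g x]. *)
  have : x - y < ((Num.floor (g x) + 1)%:~R - g x) / beta.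
    by near: y; apply: nbhs_left_ltBl; rewrite divr_gt0.
  rewrite ltr_pdivlMr// => close.
  have yx' : 0 < beta * (x - y) by rewrite mulr_gt0// subr_gt0.
  have gy : g y = g x + beta * (x - y) by rewrite !Tneg_argE; ring.
  rewrite (@Tneg_eq y (Num.floor (g x))) ?TnegE ?gy; first by ring.
  by move: close fl; rewrite intrD; lra.
apply: cvg_trans; first exact: (near_eq_cvg affine).
have lim_affine : T x + beta * (x - y) @[y --> x] --> T x + beta * (x - x).
  by apply: cvgD; [exact: cvg_cst|apply: cvgMr; apply: cvgB; [exact: cvg_cst|exact: cvg_id]].
by rewrite subrr mulr0 addr0 in lim_affine; exact: cvg_at_left_filter.
Unshelve. all: by end_near. Qed.

Lemma cut_limE x i : cut_lim beta x i = T (Defs.cut beta x i.+1).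
Proof. exact/cvg_lim/Tneg_cvg_left. Qed.

(** A point y is recovered from [T y] and k, the floor of [g y], as [- (T y + k) / beta], and 0 <
    [g y] <= [beta] on [Ibeta beta] leaves finitely many k. Finiteness keeps [fset_set] in [cuts]
    from defaulting to the empty set. *)
Lemma cuts_finite x : finite_set (`]x, next x[ `&` (Ibeta beta `&` T @^-1` V')).
Proof.
have : finite_set ((fun p : R * nat => - (p.1 + p.2%:R) / beta) @`
    (V' `*` `I_(Num.bound beta))).
  by apply/finite_image/finite_setX; [exact: V'_finite|exact: finite_II].
apply: sub_finite_set => y [_ [/=]]; rewrite /Ibeta/= in_itv/= => yI VTy.
have gy0 : 0 < g y.
  have : beta * y < beta * r by rewrite ltr_pM2l//; case/andP: yI.
  by rewrite Tneg_argE beta_Iright; lra.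
have gyb : g y <= beta.
  have : beta * L <= beta * y by rewrite ler_pM2l//; case/andP: yI.
  by rewrite Tneg_argE IleftE mulrBr beta_Iright; lra.
have f0 : 0 <= Num.floor (g y) by rewrite floor_ge0 ltW.
have fE : (`|Num.floor (g y)|%N)%:R = (Num.floor (g y))%:~R :> R.
  by rewrite -[in RHS](gez0_abs f0).
exists (T y, `|Num.floor (g y)|%N) => /=.
  split=> //=; rewrite -(ltr_nat R) fE.
  apply: le_lt_trans (archi_boundP (ltW beta_gt0)).
  by apply: le_trans gyb; case/andP: (floor_itv (g y)).
by rewrite fE TnegE IleftE Tneg_argE; field.
Qed.

(** Between consecutive cuts [T] has no jump, so it is affine of slope [- beta]. Its image is an
    open interval free of [V'] that starts at [T z], hence a whole gap once its upper end is seen to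
    be [T y] or [r]. *)
Lemma Tneg_branch y z : y < z -> V' (T y) -> V' (T z) ->
  (forall t, y < t < z -> ~ V' (T t)) ->
  (forall t, y < t <= z -> T t = T z + beta * (z - t)) /\
  next (T z) - T z = beta * (z - y).
Proof.
move=> yz Vy Vz gap; have /andP[fl fu] := floor_itv (g z).
set n := Num.floor (g z) in fl fu; rewrite intrD in fu.
have g_lt s t : s < t -> g t < g s by move=> st; rewrite ltrD2l ltrN2 ltr_pM2l.
(* Where g takes an integer value, T takes the value Ileft, which is in V'. *)
have gt t : y < t <= z -> g t < n%:~R + 1.
  move=> /andP[yt tz]; rewrite ltNge; apply/negP => ngt.
  pose s := (1 - r - n%:~R - 1) / beta.
  have gs : g s = n%:~R + 1 by rewrite Tneg_argE /s; field.
  have ts : t <= s by rewrite leNgt; apply/negP => /g_lt; rewrite gs; lra.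
  have sz : s < z.
    rewrite ltNge; apply/negP; rewrite le_eqVlt => /predU1P[zs|/g_lt]; last by rewrite gs; lra.
    by move: gs; rewrite -zs; lra.
  apply: (gap s); first by rewrite (lt_le_trans yt ts).
  by rewrite (@Tneg_arg_int s (n + 1)) ?intrD//; exact: V'_Ileft.
have affine t : y < t <= z -> T t = T z + beta * (z - t).
  move=> yt; have gtE : g t = g z + beta * (z - t) by rewrite !Tneg_argE; ring.
  have gtz : 0 <= beta * (z - t).
    by rewrite mulr_ge0 ?(ltW beta_gt0)// subr_ge0; case/andP: yt.
  have := gt t yt => gtn.
  rewrite (@Tneg_eq t n); last by rewrite gtn andbT gtE; lra.
  by rewrite TnegE gtE -/n; ring.
split=> //; apply/eqP; rewrite subr_eq addrC; apply/eqP/rnext_eq => //.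
- have gyn : g y <= n%:~R + 1.
    rewrite leNgt; apply/negP => ngy.
    (* A point of (y, z] so close to y that [g s] is still at least n + 1, against [gt]. *)
    pose s := y + Num.min (z - y) ((g y - n%:~R - 1) / beta).
    have m0 : 0 < Num.min (z - y) ((g y - n%:~R - 1) / beta).
      by rewrite lt_min subr_gt0 yz divr_gt0// -addrA -opprD subr_gt0.
    have m1 : Num.min (z - y) ((g y - n%:~R - 1) / beta) <= z - y by rewrite ge_min lexx.
    have : beta * (s - y) <= g y - n%:~R - 1.
      by rewrite mulrC -ler_pdivlMr// /s addrAC subrr add0r ge_min lexx orbT.
    have : g s < n%:~R + 1 by apply: gt; rewrite /s; lra.
    by rewrite !Tneg_argE; lra.
  have gyE : g y = g z + beta * (z - y) by rewrite !Tneg_argE; ring.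
  (* If [g y] = n + 1, then y is a jump and the image ends at [r]; otherwise the branch extends to y
     and the image ends at [T y]. *)
  move: gyn; rewrite le_eqVlt => /predU1P[gy|gy].
    right; rewrite TnegE -/n IleftE.
    by move: gyE; rewrite gy; set X := beta * _; lra.
  left; suff -> : T z + beta * (z - y) = T y by [].
  rewrite (@Tneg_eq y n) ?gy ?andbT ?TnegE -/n gyE; first by ring.
  by apply: le_trans fl _; rewrite lerDl mulr_ge0 ?(ltW beta_gt0)// subr_ge0 ltW.
- by rewrite ltrDl mulr_gt0// subr_gt0.
- move=> v Vv zv; rewrite leNgt; apply/negP => vy.
  (* The preimage of v on the affine branch. *)
  pose t := z - (v - T z) / beta.
  have d0 : 0 < (v - T z) / beta by rewrite divr_gt0// subr_gt0.
  have d1 : (v - T z) / beta < z - y.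
    by rewrite ltr_pdivrMr// [_ * beta]mulrC ltrBlDl.
  apply: (gap t); first by rewrite /t; lra.
  rewrite affine; last by rewrite /t; lra.
  by have -> : T z + beta * (z - t) = v by rewrite /t; field.
Qed.

(** * Tilings labelled by words, and the action of [psi] on them *)

(** A recursive form of [psi_hat] before reversal, in the order of the preimages. As [T] decreases
    on a branch, the image gap is named after the right end of the branch, so the left end of the
    first branch is not an argument. *)
Fixpoint image_word (s : seq R) (z : R) : seq R :=
  if s is y :: s' then hat beta (T y) :: T y :: image_word s' z
  else [:: hat beta (T z)].

Lemma image_wordE s z : image_word s z =
  hat beta (T (nth 0 (rcons s z) 0)) ::
  flatten [seq [:: T (nth 0 (rcons s z) i); hat beta (T (nth 0 (rcons s z) i.+1))]
          | i <- iota 0 (size s)].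
Proof.
elim: s => //= y s ->; congr [:: _, _, _ & _].
by rewrite (iotaDl 1 0) -map_comp.
Qed.

Lemma psi_hatE x : psi_hat beta x = rev (image_word (cuts beta x) (next x)).
Proof.
rewrite /psi_hat image_wordE cut_limE /Defs.cut /= (iotaDl 1 0) -map_comp.
congr (rev (_ :: flatten _)); apply: eq_map => i /=.
by rewrite cut_limE.
Qed.

(* [tiled F a w c]: the word [w] labels the interval (a, c), its letters read
   from left to right being the values of [F] at the division points and, in
   between, the gaps of V' onto which [F] translates the open tiles. *)
Inductive tiled (F : R -> R) : R -> seq R -> R -> Prop :=
| tiled_hat a c x : V' x -> c - a = next x - x ->
    (forall z, a < z < c -> F z = x + (z - a)) -> tiled F a [:: hat beta x] c
| tiled_cat a b c w1 w2 : tiled F a w1 b -> V' (F b) -> tiled F b w2 c ->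
    tiled F a (w1 ++ F b :: w2) c.

(** The slope [- beta] of t -> [d - beta * t] cancels that of [T], which makes [G] a translation. *)
Lemma tiled_branch G d y z : y < z -> V' (T y) -> V' (T z) ->
  (forall t, y < t < z -> ~ V' (T t)) ->
  (forall t, y < t < z -> G (d - beta * t) = T t) ->
  tiled G (d - beta * z) [:: hat beta (T z)] (d - beta * y).
Proof.
move=> yz Vy Vz gap GT; have [affine nextE] := Tneg_branch yz Vy Vz gap.
apply: tiled_hat => //; first by rewrite nextE; ring.
move=> t /andP[t1 t2].
have tE : t = d - beta * ((d - t) / beta) by field.
have /andP[yt tz] : y < (d - t) / beta < z.
  by rewrite ltr_pdivlMr// ltr_pdivrMr// ![_ * beta]mulrC; lra.
by rewrite {1}tE GT ?yt// affine ?yt ?ltW//; field.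
Qed.

(** Induction on the cuts from the left: after the orientation-reversing dilation the first branch
    becomes the rightmost tile, which matches [rev]. *)
Lemma tiled_image_word G d y s z : path <%R y (rcons s z) ->
  (forall t, t \in y :: z :: s -> V' (T t)) ->
  (forall t, y < t < z -> V' (T t) -> t \in s) ->
  (forall t, y < t < z -> G (d - beta * t) = T t) ->
  tiled G (d - beta * z) (rev (image_word s z)) (d - beta * y).
Proof.
elim: s y => [|y1 s IH] y /=.
  rewrite andbT => yz VT gap GT; apply: tiled_branch => //.
  - by apply: VT; rewrite mem_head.
  - by apply: VT; rewrite !inE eqxx orbT.
  - by move=> t /gap h /h.
move=> /andP[yy1 p1] VT gap GT.
have y1lt t : t \in rcons s z -> y1 < t.
  by move: p1; rewrite path_sortedE; [move=> /andP[/allP H _] /H|exact: lt_trans].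
have y1z : y1 < z by apply: y1lt; rewrite mem_rcons mem_head.
have Gy1 : G (d - beta * y1) = T y1 by apply: GT; rewrite yy1.
rewrite !rev_cons -!cats1 -catA /= -{1}Gy1; apply: tiled_cat.
- apply: IH => //.
  + by move=> t; rewrite !inE => H; apply: VT; rewrite !inE; case/or3P: H => ->; rewrite ?orbT.
  + move=> t /andP[y1t tz] Vt; have := gap t; rewrite (lt_trans yy1 y1t) tz inE gt_eqF//=; exact.
  + by move=> t /andP[y1t tz]; apply: GT; rewrite (lt_trans yy1).
- by rewrite Gy1; apply: VT; rewrite !inE eqxx !orbT.
- apply: tiled_branch => //.
  + by apply: VT; rewrite mem_head.
  + by apply: VT; rewrite !inE eqxx !orbT.
  + move=> t /andP[yt ty1] Vt; have := gap t; rewrite yt (lt_trans ty1)//= inE lt_eqF//=.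
    by move=> /(_ isT Vt) ts; have := y1lt t; rewrite mem_rcons inE ts orbT ltNge ltW// => /(_ isT).
  + by move=> t /andP[yt ty1]; apply: GT; rewrite yt (lt_trans ty1).
Qed.

Lemma mem_cuts x t : V' x ->
  (t \in cuts beta x) = `[< x < t < next x /\ V' (T t) >].
Proof.
move=> Vx; rewrite mem_sort in_fset_set; last exact: cuts_finite.
apply/idP/asboolP; first by rewrite inE/= in_itv/= => -[? []].
move=> [xt VTt]; rewrite inE/= in_itv/=; split=> //; split=> //.
rewrite /Ibeta/= in_itv/=; have := rnext_le Vx.
by have /andP[] := V'_range Vx; case/andP: xt; lra.
Qed.

Lemma cuts_path x : V' x -> path <%R x (rcons (cuts beta x) (next x)).
Proof.
move=> Vx; have [_ xn _] := rnextP Vx.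
have sub t : t \in cuts beta x -> x < t < next x by rewrite mem_cuts// => /asboolP[].
rewrite rcons_path path_sortedE; last exact: lt_trans.
rewrite sort_lt_sorted fset_uniq andbT; apply/andP; split.
  by apply/allP => t /sub/andP[].
by have := mem_last x (cuts beta x); rewrite inE => /predU1P[->|/sub/andP[]].
Qed.

(** A single tile is a translated gap, cut by [T] as [psi_hat] records; at a division point the new
    value is [T (F b)]. The two sides of a concatenation swap under dilation by [- beta], as they do
    under the anti-morphism. *)
Lemma tiled_psi F a w c : tiled F a w c ->
  tiled (fun z => T (F (z / - beta))) (- beta * c) (psi beta w) (- beta * a).
Proof.
elim=> {a w c} [a c x Vx ca FE|a b c w1 w2 _ IH1 VFb _ IH2].
  have [Vn xn _] := rnextP Vx.
  rewrite /psi /= cats0 /psi_letter memNset; last exact: V'_hatN.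
  (* With this d, the point [- beta * z] equals [d - beta * t] for t = x + (z - a), the point of the
     gap corresponding to z. *)
  rewrite unhatK// psi_hatE; pose d := beta * (x - a).
  have -> : - beta * c = d - beta * next x.
    by rewrite -[next x](subrK x) -ca /d; ring.
  have -> : - beta * a = d - beta * x by rewrite /d; ring.
  apply: tiled_image_word; first exact: cuts_path.
  - move=> t; rewrite !inE => /or3P[/eqP->|/eqP->|].
    + exact: V'_Tneg.
    + by case: Vn => [/V'_Tneg//|->]; rewrite Tneg_Iright; exact: V'_Ileft.
    + by rewrite mem_cuts// => /asboolP[].
  - by move=> t xt VTt; rewrite mem_cuts//; apply/asboolP.
  - move=> t /andP[xt tn].
    have -> : (d - beta * t) / - beta = a + (t - x) by rewrite /d; field.
    by rewrite FE; [congr T; ring|lra].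
have -> : psi beta (w1 ++ F b :: w2) = psi beta w2 ++ T (F b) :: psi beta w1.
  rewrite /psi map_cat rev_cat flatten_cat /= rev_cons flatten_rcons -catA.
  by rewrite /psi_letter mem_set.
have Fb : F b = F (- beta * b / - beta) by congr F; field.
by rewrite {1}Fb; apply: (tiled_cat IH2) => //; rewrite -Fb; exact: V'_Tneg.
Qed.

(** Hatted letters and division points alternate, and each of the M + 1 tiles has length at most 1.
    The length bound later forces the words to grow with [beta ^+ n]. *)
Lemma tiled_size F a w c : tiled F a w c ->
  exists M, [/\ size w = M.*2.+1, a < c & c - a <= M.+1%:R].
Proof.
elim=> {a w c} [a c x Vx ca _|a b c w1 w2 _ [M1 [s1 ab ba]] _ _ [M2 [s2 bc cb]]].
  exists 0%N; rewrite -[a < c]subr_gt0 ca rnext_sub_le1// subr_gt0; split=> //.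
  by have [] := rnextP Vx.
exists (M1 + M2).+1; split; first by rewrite size_cat/= s1 s2; lia.
  exact: lt_trans bc.
have -> : (M1 + M2).+2%:R = M1.+1%:R + M2.+1%:R :> R by rewrite -natrD; congr _%:R; lia.
lra.
Qed.

(** * Reading a tiling off the two-sided word *)

Section Reading.
Context (u : int -> R).
Local Notation Z := (zpoint beta u).

Lemma zpoint0 : Z 0 = 0.
Proof. by rewrite /zpoint/= big_geq. Qed.

(** One recurrence covers both signed sums, so tilings can be read without splitting on the sign of
    k. *)
Lemma zpointS k : Z (k + 1) = Z k + J_length beta (u (2 * k + 1)).
Proof.
have ZN n : Z (- n%:Z) = - \sum_(1 <= j < n.+1) J_length beta (u (- (2 * j%:Z) + 1)).
  case: n => [|n]; first by rewrite zpoint0 big_geq ?oppr0.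
  by [].
case: k => n.
  have -> : Posz n + 1 = n.+1%:Z by lia.
  rewrite /zpoint/= big_nat_recr//=; congr (_ + J_length _ (u _)); lia.
rewrite NegzE; have -> : - n.+1%:Z + 1 = - n%:Z by lia.
rewrite !ZN [in RHS]big_nat_recr//= opprD.
have -> : - (2 * n.+1%:Z) + 1 = 2 * - n.+1%:Z + 1 by lia.
by rewrite addrNK.
Qed.

(** The offset makes the word start just after [u (2 * k)], the letter attached to the point
    [Z k]. *)
Definition reads_at (k : int) (w : seq R) : Prop :=
  forall i, (i < size w)%N -> nth 0 w i = u (2 * k + 1 + i%:Z).

Lemma reads_at_cat k w1 p w2 M : size w1 = M.*2.+1 ->
  reads_at k (w1 ++ p :: w2) ->
  [/\ reads_at k w1, p = u (2 * (k + M.+1%:Z)) & reads_at (k + M.+1%:Z) w2].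
Proof.
move=> s1 rw; split.
- move=> i iw; rewrite -rw ?nth_cat ?iw// size_cat; lia.
- have := rw (size w1); rewrite nth_cat ltnn subnn /= size_cat /= => -> //; last by lia.
  congr u; lia.
- move=> i iw; have := rw (size w1 + i.+1)%N.
  rewrite nth_cat [(_ < size w1)%N]ltnNge leq_addr addKn /= size_cat /= => -> //; last by lia.
  congr u; lia.
Qed.

Lemma tiled_zpoint F a w c : tiled F a w c -> forall k M,
  size w = M.*2.+1 -> reads_at k w -> Z (k + M.+1%:Z) = Z k + (c - a).
Proof.
elim=> {a w c} [a c x Vx ca _|a b c w1 w2 t1 IH1 _ t2 IH2] k M sM rw.
  have -> : M = 0%N by case: M sM => //= M; rewrite doubleS.
  by rewrite zpointS ca -J_length_hat// -[hat beta x]/(nth 0 [:: hat beta x] 0) rw// addr0.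
have [M1 [s1 _ _]] := tiled_size t1; have [M2 [s2 _ _]] := tiled_size t2.
have [r1 _ r2] := reads_at_cat s1 rw.
have -> : k + M.+1%:Z = k + M1.+1%:Z + M2.+1%:Z.
  by move: sM; rewrite size_cat/= s1 s2; lia.
by rewrite (IH2 _ _ s2 r2) (IH1 _ _ s1 r1); ring.
Qed.

(** Division points are exactly the points where [F] meets [V']: inside a tile, [F] takes its values
    in an open gap. *)
Lemma tiled_reads F a w c : tiled F a w c -> forall k M,
  size w = M.*2.+1 -> reads_at k w -> a = Z k ->
  (forall j, k < j < k + M.+1%:Z -> a < Z j < c /\ F (Z j) = u (2 * j)) /\
  (forall z, a < z < c -> V' (F z) -> exists2 j, k < j < k + M.+1%:Z & z = Z j).
Proof.
elim=> {a w c} [a c x Vx ca FE|a b c w1 w2 t1 IH1 _ t2 IH2] k M sM rw ak.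
  have -> : M = 0%N by case: M sM => //= M; rewrite doubleS.
  split=> [j|z azc]; first by lia.
  by rewrite FE// => VF; case: (rnext_gap Vx _ VF); case/andP: azc; lra.
have [M1 [s1 ab _]] := tiled_size t1; have [M2 [s2 bc _]] := tiled_size t2.
have [r1 pb r2] := reads_at_cat s1 rw.
have bE : b = Z (k + M1.+1%:Z) by rewrite (tiled_zpoint t1 s1 r1) -ak; ring.
have [IH1a IH1b] := IH1 _ _ s1 r1 ak; have [IH2a IH2b] := IH2 _ _ s2 r2 bE.
have kM : k + M.+1%:Z = k + M1.+1%:Z + M2.+1%:Z.
  by move: sM; rewrite size_cat/= s1 s2; lia.
split=> [j|z] /andP[].
  move=> kj jk; case: (ltgtP j (k + M1.+1%:Z)) => [lt|gt|->].
  - by have [/andP[-> jb] ->] := IH1a j (introT andP (conj kj lt)); rewrite (lt_trans jb).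
  - have [|/andP[bj ->] ->] := IH2a j; first by rewrite gt -kM.
    by rewrite (lt_trans ab).
  - by rewrite -bE ab bc.
move=> az zc VFz; case: (ltgtP z b) => [zb|bz|->].
- have [|j /andP[kj jM] ->] := IH1b z _ VFz; first by rewrite az.
  by exists j => //; rewrite kj kM; lia.
- have [|j /andP[kj jM] ->] := IH2b z _ VFz; first by rewrite bz.
  by exists j => //; rewrite kM jM; lia.
- by exists (k + M1.+1%:Z) => //; rewrite kM; lia.
Qed.

End Reading.

(** * Iterates of [psi] as windows of the two-sided word *)

Local Notation rho := (next 0).

Lemma rnext0_range : 0 < rho <= r.
Proof. by have [_ -> _] := rnextP V'_0; rewrite rnext_le//; exact: V'_0. Qed.

(** The side of 0 alternates with the sign of [(- beta) ^+ n], matching the prefix and suffix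
    conditions on u. *)
Lemma tiled_iter_psi n :
  let F z := iter n T (z / (- beta) ^+ n) in
  let w := iter n (psi beta) [:: hat beta 0] in
  let e := (- beta) ^+ n * rho in
  if odd n then tiled F e w 0 else tiled F 0 w e.
Proof.
elim: n => [|n] /=.
  apply: tiled_hat; [exact: V'_0|by rewrite expr0 mul1r|].
  by move=> z _; rewrite expr0 divr1; ring.
have FE : (fun z => T (iter n T (z / - beta / (- beta) ^+ n))) =
          (fun z => T (iter n T (z / (- beta) ^+ n.+1))).
  by apply/funext => z; rewrite exprS invfM mulrA.
by case: odd => /= /tiled_psi; rewrite FE mulr0 mulrA -exprS.
Qed.

Lemma exp_unbounded y : exists n, forall m, (n <= m)%N -> y < beta ^+ m * rho.
Proof.
have /andP[rho_gt0 _] := rnext0_range.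
have bern m : 1 + m%:R * (beta - 1) <= beta ^+ m.
  elim: m => [|m IH]; first by rewrite mul0r addr0 expr0.
  have b1 : 0 <= beta - 1 by rewrite subr_ge0 ltW.
  apply: le_trans (_ : beta * (1 + m%:R * (beta - 1)) <= _); last by rewrite exprS ler_pM2l.
  have : 0 <= m%:R * (beta - 1) * (beta - 1) by rewrite !mulr_ge0.
  rewrite -[m.+1]addn1 natrD; lra.
have d0 : 0 < (beta - 1) * rho by rewrite mulr_gt0// subr_gt0.
exists (Num.bound (`|y| / ((beta - 1) * rho))) => m le_m.
have : `|y| / ((beta - 1) * rho) < m%:R.
  by apply: lt_le_trans (archi_boundP _) _; rewrite ?ler_nat// divr_ge0// ltW.
rewrite ltr_pdivrMr// => /(le_lt_trans (ler_norm y))/lt_le_trans; apply.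
by rewrite mulrA ler_pM2r//; apply: le_trans (bern m); rewrite lerDr.
Qed.

(** The indices covered by the n-th word form a window with one end at 0; since tiles have length at
    most 1, these windows exhaust each half-line. *)
Lemma window u (hu : psi_biinfinite_word beta u) n : exists lo hi : int,
  [/\ if odd n then hi = 0 else lo = 0,
      beta ^+ n * rho <= (hi - lo)%:~R,
      forall k, lo < k < hi -> 0 < zpoint beta u k / (- beta) ^+ n < rho /\
        iter n T (zpoint beta u k / (- beta) ^+ n) = u (2 * k)
    & forall z, 0 < z / (- beta) ^+ n < rho ->
        V' (iter n T (z / (- beta) ^+ n)) ->
        exists2 k, lo < k < hi & z = zpoint beta u k].
Proof.
have [_ _ pre suf] := hu; have := tiled_iter_psi n; rewrite /=.
have betan_gt0 : 0 < beta ^+ n by rewrite exprn_gt0.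
rewrite exprNn -signr_odd; case n_odd: (odd n) => tl; have [M [sM ac bM]] := tiled_size tl.
(* The 2M + 1 letters ending at index -1 begin at index -(2M + 1) = 2(-(M + 1)) + 1. *)
- have rw : reads_at u (- M.+1%:Z) (iter n (psi beta) [:: hat beta 0]).
    move=> i isz; have := suf n./2.
    have -> : n./2.*2.+1 = n by rewrite -[RHS]odd_double_half n_odd.
    by move=> {1}->; rewrite nth_mkseq//; congr u; rewrite sM; lia.
  have aE : (-1) ^+ true * beta ^+ n * rho = zpoint beta u (- M.+1%:Z).
    by have := tiled_zpoint tl sM rw; rewrite addNr zpoint0; lra.
  have [A B] := tiled_reads tl sM rw aE; rewrite addNr in A B.
  have range z : (0 < z / ((-1) ^+ true * beta ^+ n) < rho) =
                 ((-1) ^+ true * beta ^+ n * rho < z < 0).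
    rewrite expr1 mulN1r invrN mulrN mulNr ltrNr oppr0 ltrNl.
    by rewrite ltr_pdivrMr// mul0r ltr_pdivlMr// mulNr [rho * _]mulrC andbC.
  exists (- M.+1%:Z), 0; split=> //.
  + by move: bM; rewrite expr1 mulN1r mulNr sub0r !opprK.
  + by move=> k /A; rewrite range.
  + by move=> z; rewrite range; exact: B.
- have rw : reads_at u 0 (iter n (psi beta) [:: hat beta 0]).
    move=> i isz; have := pre n./2.
    have -> : n./2.*2 = n by rewrite -[RHS]odd_double_half n_odd.
    by move=> {1}->; rewrite nth_mkseq//; congr u; lia.
  have [A B] := tiled_reads tl sM rw (esym (zpoint0 _)); rewrite add0r in A B.
  have range z : (0 < z / ((-1) ^+ false * beta ^+ n) < rho) =
                 (0 < z < (-1) ^+ false * beta ^+ n * rho).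
    by rewrite expr0 mul1r ltr_pdivrMr// ltr_pdivlMr// mul0r [rho * _]mulrC.
  exists 0, M.+1%:Z; split=> //.
  + by move: bM; rewrite expr0 mul1r !subr0.
  + by move=> k /A; rewrite range.
  + by move=> z; rewrite range; exact: B.
Qed.

(** * Zeros of the iterates and the integers in base [- beta] *)

(** Division by [- beta] sends [L] to [r], and [r] to [- r / beta], which exceeds [L] = [- beta * r]
    because [beta] > 1. *)
Lemma divN_range (y : R) : L < y < r -> L < y / - beta < r.
Proof.
move=> yI; have br := beta_Iright.
have y1 : y < (1 - r) * beta by move: beta_gt1; lra.
have y2 : - r * beta < y by move: yI; rewrite IleftE; lra.
rewrite -ltr_pdivrMr// in y1; rewrite -ltr_pdivlMr// in y2.
by rewrite invrN mulrN IleftE; lra.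
Qed.

Lemma iter_Tneg_divN (x : R) m : L < x < r -> iter m T (x / (- beta) ^+ m) = x.
Proof.
suff H : L < x < r -> L < x / (- beta) ^+ m < r /\ iter m T (x / (- beta) ^+ m) = x.
  by move=> /H[].
move=> xI; elim: m => [|m [mI IH]]; first by rewrite expr0 divr1.
have -> : x / (- beta) ^+ m.+1 = x / (- beta) ^+ m / - beta.
  by rewrite exprSr invfM mulrA mulrAC.
rewrite iterSr Tneg_divN; last by case/andP: mI => /ltW-> ->.
by split=> //; exact: divN_range.
Qed.

(* The preimage x / -beta of x escapes [Ibeta beta] only for x = Ileft, and
   then x / beta ^+ 2 is an interior point mapped to T x by T^2. *)
Lemma neg_beta_integers_stable z : neg_beta_integers beta z ->
  exists n, forall m, iter (m + n) T (z / (- beta) ^+ (m + n)) = 0.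
Proof.
have bNn n : (- beta) ^+ n != 0 by rewrite expf_neq0// oppr_eq0.
suff stable n (x : R) : L < x < r -> iter n T x = 0 ->
    forall m, iter (n + m) T ((- beta) ^+ n * x / (- beta) ^+ (n + m)) = 0.
  case=> n _ [x [/=]]; rewrite /Ibeta/= in_itv/= => /andP[Lx xr] Tx <-.
  move: Lx; rewrite le_eqVlt => /predU1P[Lx|Lx]; last first.
    by exists n => m; rewrite addnC; apply: stable; rewrite ?Lx.
  have xE : x = - (beta * r) by rewrite beta_Iright -Lx IleftE opprB.
  have xb : x / beta ^+ 2 = - (r / beta) by rewrite xE; field.
  have TTx : T (x / beta ^+ 2) = x.
    have brb : beta * (r / beta) = r by field.
    by rewrite xb -[RHS]Lx (@Tneg_arg_int _ 1)// Tneg_argE mulrN brb; ring.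
  exists n.+2 => m.
  have -> : (- beta) ^+ n * x = (- beta) ^+ n.+2 * (x / beta ^+ 2).
    by rewrite !exprS; field.
  (* One application of [T] returns to x, so the iterate of order n + 2 at [x / beta ^+ 2] is [T 0]
     = 0. *)
  rewrite addnC; apply: stable; last by rewrite iterSr TTx iterS Tx Tneg0.
  rewrite xb.
  have : 0 < r / beta by rewrite divr_gt0// Iright_gt0.
  have : r / beta < beta * r / beta.
    by rewrite ltr_pM2r ?invr_gt0// ltr_pMl// Iright_gt0.
  rewrite mulrAC divff// mul1r IleftE; have := beta_Iright.
  have : r < beta * r by rewrite ltr_pMl// Iright_gt0.
  lra.
move=> xI Tx m; rewrite iterD exprD invfM mulrACA divff// mul1r.
by rewrite iter_Tneg_divN.
Qed.

Lemma neg_beta_integers_iter n z : 0 < z / (- beta) ^+ n < rho ->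
  iter n T (z / (- beta) ^+ n) = 0 -> neg_beta_integers beta z.
Proof.
move=> /andP[z0 zr] Tz; exists n => //; exists (z / (- beta) ^+ n); last first.
  by rewrite mulrC divfK// expf_neq0// oppr_eq0.
split=> //; rewrite /Ibeta/= in_itv/=; have /andP[_ rr] := rnext0_range.
by rewrite (lt_le_trans zr)// andbT IleftE; have := Iright_lt1; lra.
Qed.

Lemma neg_beta_integersE u : psi_biinfinite_word beta u ->
  neg_beta_integers beta = [set zpoint beta u k | k in [set k : int | u (2 * k) = 0]].
Proof.
move=> hu; have [_ u0 _ _] := hu; apply/seteqP; split=> z /=.
  move=> /neg_beta_integers_stable[n0 Tz].
  (* 0 is an end of every window, never interior, hence treated apart. *)
  have [->|z0] := eqVneq z 0; first by exists 0; rewrite ?zpoint0//= mulr0.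
  have [n1 n1P] := exp_unbounded `|z|.
  (* The parity of n gives [(- beta) ^+ n] the sign of z; n also exceeds both thresholds [n0] and
     [n1]. *)
  pose n := ((z < 0)%R + (n0 + n1).*2)%N.
  have zn : 0 < z / (- beta) ^+ n < rho.
    have bn : 0 < beta ^+ n by rewrite exprn_gt0.
    have : `|z| < beta ^+ n * rho by apply: n1P; rewrite /n; lia.
    rewrite exprNn -signr_odd oddD odd_double addbF oddb.
    case: (ltgtP z 0) z0 => // zs _ zb.
      rewrite expr1 mulN1r invrN mulrN -mulNr ltr_pdivlMr// ltr_pdivrMr// mul0r.
      by rewrite oppr_gt0 zs -(ltr0_norm zs) mulrC.
    rewrite expr0 mul1r ltr_pdivlMr// ltr_pdivrMr// mul0r zs.
    by rewrite -{1}(gtr0_norm zs) mulrC.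
  have Tn : iter n T (z / (- beta) ^+ n) = 0.
    have -> : n = (n - n0 + n0)%N by rewrite /n; lia.
    exact: Tz.
  have [lo [hi [_ _ A B]]] := window hu n.
  have [|k kI zk] := B z zn; first by rewrite Tn; exact: V'_0.
  by exists k => //=; have [_] := A k kI; rewrite -zk Tn.
move=> [k uk <-].
have [->|k0] := eqVneq k 0.
  rewrite zpoint0; exists 0%N => //; exists 0; rewrite ?mulr0//; split=> //.
  by rewrite /Ibeta/= in_itv/=; exact: V'_range V'_0.
have [n1 n1P] := exp_unbounded `|k|%:~R.
(* The parity puts the window on the side of k, and [n1] makes it longer than |k|. *)
pose n := ((k < 0)%R + n1.*2)%N.
have [lo [hi [lohi len A _]]] := window hu n.
have : `|k|%:~R < (hi - lo)%:~R :> R by apply: lt_le_trans len; apply: n1P; rewrite /n; lia.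
rewrite ltr_int => klen.
have [|zn Tz] := A k.
  move: lohi; rewrite /n oddD odd_double addbF oddb; case: ifPn; lia.
by apply: (neg_beta_integers_iter zn); rewrite Tz.
Qed.

End TnegTiling.

Theorem theorem3p4 (R : realType) (beta : R)
    (hbeta : (1 + Num.sqrt 5) / 2 <= beta) (hyrrap : yrrap beta)
    (u : int -> R) (hu : psi_biinfinite_word beta u) :
  neg_beta_integers beta =
    [set zpoint beta u k | k in [set k : int | u (2 * k) = 0]].
Proof.
apply: neg_beta_integersE => //; apply: lt_le_trans hbeta.
have : Num.sqrt 1 < Num.sqrt 5 :> R by rewrite ltr_sqrt ?ltr1n.
by rewrite sqrtr1; lra.
Qed.
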